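(* Let $G$ be a finite group and let $\varphi: G\to G$ be a group endomorphism. Then: (1) $\mathrm{nil}(\varphi)$ is the largest subgroup of $G$ invariant under $\varphi$ on which the corresponding restriction of $\varphi$ is nilpotent (i.e. it is such a subgroup and contains every other such subgroup). Also, $\mathrm{nil}(\varphi)$ is normal in $G$. (2) $\mathrm{per}(\varphi)$ is the largest subgroup of $G$ invariant under $\varphi$ on which the corresponding restriction of $\varphi$ is an automorphism (i.e. it is such a subgroup and contains every other such subgroup). (3) $G=\mathrm{nil}(\varphi)\rtimes\mathrm{per}(\varphi)$ (internal semidirect product with normal factor $\mathrm{nil}(\varphi)$). (4) The finite dynamical system $(G,\varphi)$ is (isomorphic to) the product of the finite dynamical systems $(\mathrm{nil}(\varphi),\varphi_{|\mathrm{nil}(\varphi)})$ and $(\mathrm{per}(\varphi),\varphi_{|\mathrm{per}(\varphi)})$. In particular, the state space $\Gamma_{\varphi}$ is (isomorphic to) the graph tensor product of a finite directed $1$-tree whose cycle is a loop with a disjoint union of directed cycles.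
   Context: A finite dynamical system (FDS) is a pair $(X,f)$ with $X$ a finite set and $f:X\to X$ a function; $f^n$ denotes the $n$-th iterate. A point $x\in X$ is periodic if $f^n(x)=x$ for some positive integer $n$. The state space $\Gamma_f$ is the digraph with vertex set $X$ having a directed edge from $x$ to $y$ if and only if $y=f(x)$ (loops allowed). The product of FDSs $(X,f)$ and $(Y,g)$ is $(X\times Y,f\times g)$ with $(f\times g)(x,y)=(f(x),g(y))$; one has $\Gamma_{f\times g}=\Gamma_f\times\Gamma_g$, where $\times$ on the right denotes the graph tensor product (there is an edge from $(x,y)$ to $(x',y')$ iff there are edges from $x$ to $x'$ and from $y$ to $y'$). An isomorphism between FDSs $(X,f)$ and $(Y,g)$ is a bijection $\alpha:X\to Y$ with $\alpha\circ f=g\circ\alpha$. A finite directed $1$-tree (as a state space) is a finite weakly connected digraph in which every vertex has exactly one outgoing edge; it contains exactly one directed cycle. Its cycle is a loop if that cycle has length $1$. A cycle of length $1$ (a single vertex with a loop) is allowed in a disjoint union of cycles. For an endomorphism $\varphi$ of a finite group $G$: $\mathrm{nil}(\varphi):=\{g\in G\mid \exists n\in\mathbb{N}^+:\varphi^n(g)=1\}$, where $\mathbb{N}^+$ is the set of positive integers, and $\mathrm{per}(\varphi)$ is the set of periodic points of $\varphi$. The endomorphism $\varphi$ is called nilpotent if $\mathrm{nil}(\varphi)=G$. A subgroup $H$ is invariant under $\varphi$ if $\varphi(H)\subseteq H$. *)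

(* Defs.v *)
(* boolp supplies `[< P >], the boolean reflecting a proposition P. *)
From HB Require Import structures.
From mathcomp Require Import all_boot all_fingroup.
From mathcomp Require Import boolp.

Set Implicit Arguments.
Unset Strict Implicit.
Unset Printing Implicit Defensive.

Local Open Scope group_scope.

(* A finite dynamical system is a map f : X -> X on a finType X; its state
   space is the relation frel f on X. *)

Definition fds_prod (X Y : finType) (f : X -> X) (g : Y -> Y) :
  X * Y -> X * Y := fun u => (f u.1, g u.2).

Definition fds_iso (X Y : finType) (f : X -> X) (g : Y -> Y) : Prop :=
  exists a : X -> Y, bijective a /\ a \o f =1 g \o a.

Definition fstable (X : finType) (f : X -> X) (A : {set X}) : bool :=
  f @: A \subset A.

Definition fds_restr (X : finType) (f : X -> X) (A : {set X})
    (fA : fstable f A) : {x : X | x \in A} -> {x : X | x \in A} :=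
  fun u => exist _ (f (val u)) (subsetP fA _ (imset_f f (valP u))).

(* For f-stable A, this is per of f restricted to A. *)
Definition per (X : finType) (f : X -> X) (A : {set X}) : {set X} :=
  [set x in A | `[< exists n : nat, (0 < n)%N /\ iter n f x = x >]].

Definition digraph_iso (X Y : finType) (e : rel X) (e' : rel Y) : Prop :=
  exists a : X -> Y, bijective a /\ forall x y, e' (a x) (a y) = e x y.

Definition tensor (X Y : finType) (e : rel X) (e' : rel Y) : rel (X * Y) :=
  fun u v => e u.1 v.1 && e' u.2 v.2.

Definition weakly_connected (X : finType) (e : rel X) : Prop :=
  forall x y : X, connect (fun u v => e u v || e v u) x y.

Definition one_tree (X : finType) (e : rel X) : Prop :=
  [/\ (0 < #|X|)%N, weakly_connected e
    & forall x : X, #|[set y | e x y]| = 1%N].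

(* A directed cycle, listed from one of its vertices. *)
Definition dicycle (X : finType) (e : rel X) (c : seq X) : bool :=
  (c != [::]) && ucycleb e c.

Definition loop_one_tree (X : finType) (e : rel X) : Prop :=
  one_tree e /\ exists x : X, forall c : seq X, dicycle e c <-> c = [:: x].

(* The directed cycle 0 -> 1 -> ... -> n-1 -> 0; a loop when n = 1. *)
Definition cycle_graph (n : nat) : rel 'I_n :=
  fun i j => j == i.+1 %% n :> nat.

Definition disjoint_union (I : finType) (V : I -> finType)
    (E : forall i, rel (V i)) : rel {i : I & V i} :=
  fun u v => (tag u == tag v) && E (tag u) (tagged u) (tagged_as u v).

Definition disjoint_cycles (k : nat) (n : 'I_k -> nat) :
    rel {i : 'I_k & 'I_(n i)} :=
  disjoint_union (fun i => @cycle_graph (n i)).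

(* For f-stable A, this is nil of f restricted to A. *)
Definition nilset (gT : finGroupType) (f : gT -> gT) (A : {set gT}) :
    {set gT} :=
  [set g in A | `[< exists n : nat, (0 < n)%N /\ iter n f g = 1 >]].

Definition nilpotent_on (gT : finGroupType) (f : gT -> gT) (A : {set gT}) :
  Prop := nilset f A = A.

Definition largest_subgroup (gT : finGroupType) (G : {group gT})
    (P : {set gT} -> Prop) (K : {set gT}) : Prop :=
  [/\ group_set K, K \subset G, P K
    & forall H : {group gT}, H \subset G -> P H -> H \subset K].

(* Main.v *)
Require Import Defs.
From HB Require Import structures.
From mathcomp Require Import all_boot all_fingroup.
From mathcomp Require Import boolp.

(** Some iterate of [phi] is idempotent: there is an [M > 0] with
    [phi^(2M) = phi^M] ([iter_idem]).  This reduces nilpotence and periodicity,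
    which quantify over all exponents, to the single exponent [M]: a point is
    periodic iff [phi^M] fixes it ([mem_perE]), and an element is nilpotent iff
    [phi^M] kills it ([mem_nilE]).  Since [phi^M] is an
    endomorphism [psi] of [G], this says that [nil phi] is the kernel of [psi]
    and [per phi] its image, with [psi] a retraction onto that image.  Hence
    [nil phi] is a normal subgroup, [per phi] is a subgroup, and they are
    complements of each other ([nil_per_sdprod]), the decomposition of [x] being
    [x = (x * (psi x)^-1) * psi x].  As [psi] commutes with [phi], the two
    coordinates of this decomposition are equivariant, so that it is also an
    isomorphism of dynamical systems ([fds_iso_nil_per]).

    The maximality of [nil phi] is a pointwise matter.  For [per phi], if [phi]
    is injective on a stable [H], so is [psi], and cancelling [psi] in
    [psi (psi x) = psi x] shows that every [x] in [H] is periodic.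

    For the state spaces, every point of [nil phi] flows to the fixed point [1],
    and no other point is periodic, so the first factor is a tree rooted at a
    loop ([frel_loop_one_tree]).  The second factor is the graph of a
    permutation, hence the disjoint union of its orbits, each of which is
    a directed cycle ([inj_disjoint_cycles]). *)

Set Implicit Arguments.
Unset Strict Implicit.
Unset Printing Implicit Defensive.

Local Open Scope group_scope.

(** * Idempotent iterates and periodic points *)

(** Every orbit enters its cycle after at most [#|X|] steps, and the length of
    the cycle divides [#|X|`!]; so this exponent works for all points at once. *)
Lemma iter_idem (X : finType) (f : X -> X) :
  exists2 M, (0 < M)%N & forall x, iter M f (iter M f x) = iter M f x.
Proof.
exists (#|X|`!); first exact: fact_gt0.
move=> x; set M := #|X|`!.
have /trajectP[i lt_i eq_i] := looping_order f x.
set n := fingraph.order f x in lt_i eq_i.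
have le_nX : (n <= #|X|)%N by exact: max_card.
have period m : (i <= m)%N -> iter (n - i + m) f x = iter m f x.
  move=> /subnK <-; rewrite addnCA iterD subnK 1?ltnW // eq_i.
  by rewrite -iterD.
have periods q m : (i <= m)%N -> iter (q * (n - i) + m) f x = iter m f x.
  elim: q => [|q IHq] le_im //; rewrite mulSn -addnA period ?IHq //.
  exact: leq_trans le_im (leq_addl _ _).
have /dvdnP[q defM] : (n - i %| M)%N.
  by rewrite dvdn_fact // subn_gt0 lt_i (leq_trans (leq_subr _ _)).
rewrite -iterD {1}defM periods //.
exact: leq_trans (leq_trans (ltnW lt_i) le_nX) (fact_geq _).
Qed.

Lemma iter_idem_mul (X : Type) (f : X -> X) M n x :
  (forall x, iter M f (iter M f x) = iter M f x) -> (0 < n)%N ->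
  iter (n * M) f x = iter M f x.
Proof.
move=> idem; elim: n => // -[|n] IHn _; first by rewrite mul1n.
by rewrite mulSn iterD IHn.
Qed.

Lemma iter_fix (X : Type) (f : X -> X) n x : f x = x -> iter n f x = x.
Proof. by move=> fx; elim: n => //= n ->. Qed.

Lemma iter_fix_mul (X : Type) (f : X -> X) n q x :
  iter n f x = x -> iter (q * n) f x = x.
Proof. by move=> fx; elim: q => // q IHq; rewrite mulSn iterD IHq. Qed.

Lemma iter_fstable (X : finType) (f : X -> X) (A : {set X}) n x :
  fstable f A -> x \in A -> iter n f x \in A.
Proof.
move=> fA xA; elim: n => //= n IHn.
by apply: (subsetP fA); apply: imset_f.
Qed.

Lemma iter_inj_in (X : finType) (f : X -> X) (A : {set X}) n :
  fstable f A -> {in A &, injective f} -> {in A &, injective (iter n f)}.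
Proof.
move=> fA injf x y xA yA; elim: n => //= n IHn /injf eqn.
by apply/IHn/eqn; exact: iter_fstable.
Qed.

(** If [f^n] fixes [x], so does [f^(n M)], which is [f^M] by idempotence. *)
Lemma mem_perE (X : finType) (f : X -> X) (A : {set X}) M x :
    (0 < M)%N -> (forall x, iter M f (iter M f x) = iter M f x) ->
  (x \in per f A) = (x \in A) && (iter M f x == x).
Proof.
move=> M0 idem; rewrite inE; congr (_ && _); apply/asboolP/eqP; last first.
  by move=> fx; exists M.
move=> [n [n0 fx]]; rewrite -(iter_idem_mul x idem n0) mulnC.
exact: iter_fix_mul.
Qed.

Lemma per_fstable (X : finType) (f : X -> X) (A : {set X}) :
  fstable f A -> fstable f (per f A).
Proof.
move=> fA; apply/subsetP=> _ /imsetP[x xP ->].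
move: xP; rewrite !inE => /andP[xA /asboolP[n [n0 fx]]].
rewrite (subsetP fA) ?imset_f //=; apply/asboolP; exists n; split=> //.
by rewrite -iterSr iterS fx.
Qed.

(** On periodic points [f] has the left inverse [f^(M-1)]. *)
Lemma per_inj (X : finType) (f : X -> X) (A : {set X}) :
  {in per f A &, injective f}.
Proof.
move=> x y; have [[//|M] _ idem] := iter_idem f.
rewrite !(mem_perE _ _ _ idem) // => /andP[_ /eqP fx] /andP[_ /eqP fy] eqf.
by rewrite -fx -fy !iterSr eqf.
Qed.

(** If [f] is injective on [A], then so is its idempotent power, and an
    injective idempotent map is the identity. *)
Lemma inj_sub_per (X : finType) (f : X -> X) (A : {set X}) :
  fstable f A -> {in A &, injective f} -> A \subset per f A.
Proof.
move=> fA injf; have [M M0 idem] := iter_idem f.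
apply/subsetP=> x xA; rewrite (mem_perE _ _ M0 idem) xA /=.
apply/eqP/(iter_inj_in (n := M) fA injf) => //; exact: iter_fstable.
Qed.

Lemma iter_fds_restr (X : finType) (f : X -> X) (A : {set X})
    (fA : fstable f A) n u :
  val (iter n (fds_restr fA) u) = iter n f (val u).
Proof. by elim: n => //= n ->. Qed.

(** * Nilpotent and periodic parts of an endomorphism *)

Lemma iter_morphM (gT : finGroupType) (G : {group gT})
    (phi : {morphism G >-> gT}) (phiG : fstable phi G) n :
  {in G &, {morph iter n phi : x y / x * y}}.
Proof.
move=> x y xG yG; elim: n => //= n ->.
by rewrite morphM // iter_fstable.
Qed.

Definition iter_morphism (gT : finGroupType) (G : {group gT})
    (phi : {morphism G >-> gT}) (phiG : fstable phi G) n :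
  {morphism G >-> gT} := Morphism (iter_morphM phiG n).

(** If [f^n] kills [x], so does [f^(n M)] as [1] is fixed, and the latter is
    [f^M] by idempotence. *)
Lemma mem_nilE (gT : finGroupType) (f : gT -> gT) (A : {set gT}) M x :
    f 1 = 1 -> (0 < M)%N ->
    (forall x, iter M f (iter M f x) = iter M f x) ->
  (x \in nilset f A) = (x \in A) && (iter M f x == 1).
Proof.
move=> f1 M0 idem; rewrite inE; congr (_ && _); apply/asboolP/eqP; last first.
  by move=> fx; exists M.
move=> [n [n0 fx]]; rewrite -(iter_idem_mul x idem n0).
case: M M0 {idem} => // M _; rewrite mulnC mulSn addnC iterD fx.
exact: iter_fix.
Qed.

Lemma nil_fstable (gT : finGroupType) (f : gT -> gT) (A : {set gT}) :
  f 1 = 1 -> fstable f A -> fstable f (nilset f A).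
Proof.
move=> f1 fA; apply/subsetP=> _ /imsetP[x xN ->].
move: xN; rewrite !inE => /andP[xA /asboolP[n [n0 fx]]].
rewrite (subsetP fA) ?imset_f //=; apply/asboolP; exists n; split=> //.
by rewrite -iterSr iterS fx.
Qed.

Lemma nilset_nilpotent (gT : finGroupType) (f : gT -> gT) (A : {set gT}) :
  nilpotent_on f (nilset f A).
Proof. by apply/setP=> x; rewrite !inE -andbA andbb. Qed.

Lemma nilpotent_sub_nilset (gT : finGroupType) (f : gT -> gT)
    (A B : {set gT}) :
  B \subset A -> nilpotent_on f B -> B \subset nilset f A.
Proof.
move=> sBA nilB; apply/subsetP=> x xB; move: (xB); rewrite -{1}nilB !inE.
by case/andP=> _ ->; rewrite (subsetP sBA).
Qed.

Lemma nil_ker (gT : finGroupType) (G : {group gT})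
    (phi : {morphism G >-> gT}) (phiG : fstable phi G) M :
    (0 < M)%N -> (forall x, iter M phi (iter M phi x) = iter M phi x) ->
  nilset phi G = 'ker (iter_morphism phiG M).
Proof.
move=> M0 idem; apply/setP=> x.
by rewrite (mem_nilE _ _ (morph1 phi) M0 idem) !inE.
Qed.

Lemma per_im (gT : finGroupType) (G : {group gT})
    (phi : {morphism G >-> gT}) (phiG : fstable phi G) M :
    (0 < M)%N -> (forall x, iter M phi (iter M phi x) = iter M phi x) ->
  per phi G = iter_morphism phiG M @* G.
Proof.
move=> M0 idem; apply/setP=> x; rewrite (mem_perE _ _ M0 idem).
apply/andP/morphimP => [[xG /eqP fx]|[y yG _ ->]]; first by exists x.
by rewrite /= iter_fstable // idem.
Qed.

(** The kernel and the image of an idempotent endomorphism [psi] are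
    complements: [psi] is trivial on the kernel and the identity on the image,
    and it kills [x * (psi x)^-1]. *)
Lemma nil_per_sdprod (gT : finGroupType) (G : {group gT})
    (phi : {morphism G >-> gT}) :
  fstable phi G -> nilset phi G ><| per phi G = G.
Proof.
move=> phiG; have [M M0 idem] := iter_idem phi.
have perE := mem_perE G _ M0 idem.
rewrite (nil_ker phiG M0 idem) (per_im phiG M0 idem) in perE *.
set psi := iter_morphism phiG M in perE *.
have sPG : psi @* G \subset G by apply/subsetP=> x; rewrite perE => /andP[].
rewrite sdprodE ?(subset_trans sPG) ?ker_norm //; last first.
  apply/trivgP/subsetP=> x; rewrite inE perE => /andP[/mker psix].
  by case/andP=> _ /eqP <-; rewrite inE; apply/eqP.
apply/eqP; rewrite eqEsubset mul_subG ?subsetIl //=.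
apply/subsetP=> x xG; rewrite -(mulgKV (psi x) x).
have psixP : psi x \in psi @* G by rewrite mem_morphim.
have psixG := subsetP sPG _ psixP.
apply: mem_mulg => //; apply/kerP; first by rewrite groupM ?groupV.
by rewrite morphM ?groupV // morphV //= idem mulgV.
Qed.

(** A stable finite set on which [phi] is injective is mapped onto itself, by
    counting; [misom] asks for this on the elements other than [1]. *)
Lemma per_misom (gT : finGroupType) (G : {group gT})
    (phi : {morphism G >-> gT}) :
  fstable phi G -> misom (per phi G) (per phi G) phi.
Proof.
move=> phiG; have sPG : per phi G \subset G by apply/subsetP=> x /setIdP[].
have P1 : 1 \in per phi G.
  by rewrite inE group1; apply/asboolP; exists 1%N; split; last exact: morph1.
apply/andP; split.
  apply/morphicP=> x y xP yP; apply: (morphM phi); exact: subsetP sPG _ _.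
rewrite /isom eqEcard card_in_imset ?leqnn ?andbT; last first.
  by move=> x y /setD1P[_ xP] /setD1P[_ yP]; exact: (per_inj xP yP).
apply/subsetP=> _ /imsetP[x /setD1P[x1 xP] ->]; apply/setD1P; split.
  apply: contraNneq x1 => phix; apply/eqP; apply: (per_inj xP P1).
  by rewrite phix morph1.
exact: subsetP (per_fstable phiG) _ (imset_f _ xP).
Qed.

Lemma misom_sub_per (gT : finGroupType) (f : gT -> gT) (A : {set gT})
    (H : {group gT}) :
  H \subset A -> fstable f H -> misom H H f -> H \subset per f A.
Proof.
move=> sHA fH /misomP[fM isoH].
have injf : {in H &, injective f} by apply/injmP: (isom_inj isoH).
apply: subset_trans (inj_sub_per fH injf) _; apply/subsetP=> x.
by rewrite !inE => /andP[xH ->]; rewrite (subsetP sHA).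
Qed.

(** * The decomposition as a dynamical system *)

Lemma fds_iso_nil_per (gT : finGroupType) (G : {group gT})
    (phi : {morphism G >-> gT}) (phiG : fstable phi G)
    (phiN : fstable phi (nilset phi G)) (phiP : fstable phi (per phi G)) :
  fds_iso (fds_restr phiG) (fds_prod (fds_restr phiN) (fds_restr phiP)).
Proof.
have [M M0 idem] := iter_idem phi.
have nilE x := mem_nilE G x (morph1 phi) M0 idem.
have perE x := mem_perE G x M0 idem.
have psiM := iter_morphM phiG M.
have psiV : {in G, {morph iter M phi : x / x^-1}}.
  by move=> x xG; exact: (morphV (iter_morphism phiG M)).
have psiG x : x \in G -> iter M phi x \in G by exact: iter_fstable.
have nilP x : x \in G -> x * (iter M phi x)^-1 \in nilset phi G.
  by move=> xG; rewrite nilE groupM ?groupV ?psiM ?psiV ?groupV ?psiG //=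
    idem mulgV.
have perP x : x \in G -> iter M phi x \in per phi G.
  by move=> xG; rewrite perE psiG //= idem.
have mulP (n p : gT) : n \in nilset phi G -> p \in per phi G -> n * p \in G.
  by rewrite nilE perE => /andP[nG _] /andP[pG _]; rewrite groupM.
pose a (u : {x | x \in gval G}) :=
  (exist (fun x => x \in nilset phi G) _ (nilP _ (valP u)),
   exist (fun x => x \in per phi G) _ (perP _ (valP u))).
pose b (v : {x | x \in nilset phi G} * {x | x \in per phi G}) :=
  exist (fun x => x \in gval G) _ (mulP _ _ (valP v.1) (valP v.2)).
exists a; split; last first.
  move=> u; congr (_, _); apply: val_inj => /=; rewrite -iterSr iterS //.
  by rewrite morphM ?morphV ?groupV ?psiG ?(valP u).
exists b => [u|[n p]]; first by apply: val_inj; rewrite /= mulgKV.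
have:= valP n; have:= valP p; rewrite nilE perE.
move=> /andP[pG /eqP psip] /andP[nG /eqP psin].
by congr (_, _); apply: val_inj; rewrite /= psiM // psin psip mul1g ?mulgK.
Qed.

(** * State spaces *)

(** All orbits meet at the fixed point [x0], whence connectedness; and on
    a directed cycle every point recurs, hence equals [x0]. *)
Lemma frel_loop_one_tree (X : finType) (f : X -> X) (x0 : X) :
    f x0 = x0 -> (forall x, exists n, iter n f x = x0) ->
  loop_one_tree (frel f).
Proof.
move=> fx0 to_x0; split; first split.
- by apply/card_gt0P; exists x0.
- pose e : rel X := fun u v => frel f u v || frel f v u.
  have e_sym : connect_sym e.
    by apply: sym_connect_sym => u v; rewrite /e /= orbC.
  have e_x0 x : connect e x x0.
    have [n <-] := to_x0 x; apply: connect_sub (fconnect_iter f n x).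
    by move=> u v fuv; apply: connect1; rewrite /e /= [f u == v]fuv.
  by move=> x y; apply: (@connect_trans _ e _ _ _ (e_x0 x)); rewrite e_sym.
- by move=> x; rewrite -(cards1 (f x)); apply: eq_card => y; rewrite !inE eq_sym.
exists x0 => c; split=> [|->]; last by rewrite /dicycle /ucycleb /= fx0 eqxx.
case/andP=> c0 /andP[cyc_c uniq_c].
have c_x0 x : x \in c -> x = x0.
  move=> xc; have [n fx] := to_x0 x.
  have per_x : iter (fingraph.order f x) f x = x.
    exact: (iter_order_cycle cyc_c xc xc).
  rewrite -(iter_fix_mul n per_x) -(subnK (leq_pmulr n (fingraph.order_gt0 f x))).
  by rewrite iterD fx iter_fix.
case: c c0 uniq_c c_x0 {cyc_c} => // x [|y c] _ /= uniq_c c_x0.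
  by rewrite [x]c_x0 ?mem_head.
move: uniq_c; rewrite [y]c_x0 ?inE ?eqxx ?orbT //.
by rewrite [x]c_x0 ?mem_head // eqxx.
Qed.

Lemma digraph_iso_sym (X Y : finType) (e : rel X) (e' : rel Y) :
  digraph_iso e e' -> digraph_iso e' e.
Proof.
case=> a [[b aK bK] ae]; exists b; split; first by exists a.
by move=> x y; rewrite -ae !bK.
Qed.

Lemma digraph_iso_trans (X Y Z : finType) (e1 : rel X) (e2 : rel Y)
    (e3 : rel Z) :
  digraph_iso e1 e2 -> digraph_iso e2 e3 -> digraph_iso e1 e3.
Proof.
case=> a [bij_a ae] [b [bij_b be]]; exists (b \o a).
by split=> [|x y]; [exact: bij_comp | rewrite /= be ae].
Qed.

Lemma digraph_iso_tensorr (X Y Z : finType) (e : rel X) (e1 : rel Y)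
    (e2 : rel Z) :
  digraph_iso e1 e2 -> digraph_iso (tensor e e1) (tensor e e2).
Proof.
case=> a [[b aK bK] ae]; exists (fun u => (u.1, a u.2)); split.
  by exists (fun u => (u.1, b u.2)) => [] [x y] /=; rewrite ?aK ?bK.
by move=> u v; rewrite /tensor /= ae.
Qed.

Lemma fds_iso_prod_tensor (X Y Z : finType) (f : X -> X) (g : Y -> Y)
    (h : Z -> Z) :
  fds_iso f (fds_prod g h) -> digraph_iso (frel f) (tensor (frel g) (frel h)).
Proof.
case=> a [bij_a af]; exists a; split=> // x y.
rewrite /= -(inj_eq (bij_inj bij_a)) [a (f x)]af /=.
by rewrite [a y]surjective_pairing xpair_eqE.
Qed.

(** The cycles are the orbits of [f], each one numbered from its canonical
    representative. *)
Lemma inj_disjoint_cycles (X : finType) (f : X -> X) :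
    injective f ->
  exists k (n : 'I_k -> nat), (forall i, (0 < n i)%N) /\
    digraph_iso (frel f) (@disjoint_cycles k n).
Proof.
move=> injf; pose rep (i : 'I_#|froots f|) : X := enum_val i.
have rep_root i : froot f (rep i) = rep i by apply/eqP; exact: (enum_valP i).
exists #|froots f|, (fun i => fingraph.order f (rep i)).
have n_gt0 i : (0 < fingraph.order f (rep i))%N := fingraph.order_gt0 f _.
split=> //; pose T i := 'I_(fingraph.order f (rep i)).
pose V := {i & T i}.
pose b (u : V) := iter (tagged u) f (rep (tag u)).
have b_inj : injective b.
  move=> [i j] [i' j']; rewrite /b /= => eqb.
  have eq_i : i = i'.
    apply: enum_val_inj; rewrite -[LHS]rep_root -[RHS]rep_root.
    apply/(rootP (fconnect_sym injf)).
    apply: connect_trans (fconnect_iter f j _) _; rewrite eqb.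
    by rewrite fconnect_sym // fconnect_iter.
  rewrite -{i'}eq_i in j' eqb *; congr (Tagged _ _); apply: val_inj => /=.
  by rewrite -(findex_iter (ltn_ord j)) eqb findex_iter.
have b_surj x : exists u, b u = x.
  have rx : froot f x \in froots f by exact: (roots_root (fconnect_sym injf)).
  have rep_x : rep (enum_rank_in rx (froot f x)) = froot f x.
    exact: enum_rankK_in.
  have con_x : fconnect f (rep (enum_rank_in rx (froot f x))) x.
    by rewrite rep_x (fconnect_sym injf) connect_root.
  exists (Tagged T (Ordinal (findex_max con_x))); exact: iter_findex.
apply: digraph_iso_sym; exists b; split.
  have b_codom x : x \in codom b by have [u <-] := b_surj x; exact: codom_f.
  exists (fun x => iinv (b_codom x)) => [u|x]; last exact: f_iinv.
  by apply: b_inj; rewrite f_iinv.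
(* The union of the cycles is itself the graph of a map, the successor on each
   cycle, and b conjugates this map to f. *)
pose s (u : V) : V :=
  Tagged T (Ordinal (ltn_pmod (tagged u).+1 (n_gt0 (tag u)))).
have bs u : f (b u) = b (s u).
  rewrite /b /= -iterS; set m := (tagged u).+1.
  rewrite {1}(divn_eq m (fingraph.order f (rep (tag u)))) addnC iterD.
  by rewrite iter_fix_mul // iter_order.
move=> [i j] [i' j']; rewrite /= bs (inj_eq b_inj) /disjoint_cycles.
rewrite /disjoint_union -tag_eqE /tag_eq /=.
case: (eqVneq i i') => // eq_i; rewrite -{i'}eq_i in j' *.
by rewrite !tagged_asE /cycle_graph eq_sym.
Qed.

Theorem theorem1 (gT : finGroupType) (G : {group gT})
    (phi : {morphism G >-> gT}) (phiG : fstable phi G) :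
  [/\ largest_subgroup G (fun H => fstable phi H /\ nilpotent_on phi H)
        (nilset phi G)
      /\ nilset phi G <| G,
      largest_subgroup G (fun H => fstable phi H /\ misom H H phi)
        (per phi G),
      nilset phi G ><| per phi G = G
    & (exists (phiN : fstable phi (nilset phi G))
              (phiP : fstable phi (per phi G)),
         fds_iso (fds_restr phiG)
           (fds_prod (fds_restr phiN) (fds_restr phiP)))
      /\ (exists (X : finType) (e : rel X) (k : nat) (n : 'I_k -> nat),
            [/\ loop_one_tree e, forall i, (0 < n i)%N
              & digraph_iso (frel (fds_restr phiG))
                  (tensor e (@disjoint_cycles k n))])].
Proof.
have [M M0 idem] := iter_idem phi.
have nilK := nil_ker phiG M0 idem; have perI := per_im phiG M0 idem.
have phiN := nil_fstable (morph1 phi) phiG; have phiP := per_fstable phiG.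
have sNG : nilset phi G \subset G by apply/subsetP=> x /setIdP[].
have sPG : per phi G \subset G by apply/subsetP=> x /setIdP[].
have iso_prod := fds_iso_nil_per phiG phiN phiP.
split.
- split; last by rewrite nilK ker_normal.
  split=> // [||H sHG [_ nilH]]; first by rewrite nilK groupP.
    by split=> //; exact: nilset_nilpotent.
  exact: nilpotent_sub_nilset.
- split=> // [||H sHG [fH isoH]]; first by rewrite perI groupP.
    by split=> //; exact: per_misom.
  exact: misom_sub_per.
- exact: nil_per_sdprod.
split; first by exists phiN, phiP.
have injP : injective (fds_restr phiP).
  move=> u v /(congr1 val) /= eq_uv; apply: val_inj.
  exact: per_inj (valP u) (valP v) eq_uv.
have [k [n [n_gt0 cyclesP]]] := inj_disjoint_cycles injP.
exists _, (frel (fds_restr phiN)), k, n; split=> //; last first.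
  apply: digraph_iso_trans (fds_iso_prod_tensor iso_prod) _.
  exact: digraph_iso_tensorr.
have N1 : 1 \in nilset phi G by rewrite nilK group1.
apply: (@frel_loop_one_tree _ _ (exist _ 1 N1)) => [|u].
  by apply: val_inj; exact: morph1.
have /setIdP[_ /asboolP[m [_ phiu]]] := valP u.
by exists m; apply: val_inj; rewrite iter_fds_restr.
Qed.
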